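(* Let $q=p^{k}$ be a power of a prime $p$ (with $k\geq 1$). Then $\mathbb{F}_{q}[[t]]$ is existentially definable in $\mathbb{F}_{q}((t))$ using no parameters; that is, there is an existential $\mathcal{L}_{\mathrm{ring}}$-formula $\chi(x)$ without parameters such that, for every $a\in\mathbb{F}_{q}((t))$, $\mathbb{F}_{q}((t))\models\chi(a)$ if and only if $a\in\mathbb{F}_{q}[[t]]$.
   Context: $\mathcal{L}_{\mathrm{ring}}$ is the first-order language of rings. $\mathbb{F}_{q}((t))$ is the field of formal power (Laurent) series over the finite field $\mathbb{F}_{q}$ with $q$ elements, and $\mathbb{F}_{q}[[t]]$ is its subring of formal power series, i.e. the valuation ring of the $t$-adic valuation. The formula $\chi$ is allowed to depend on $q$. *)

(* Defs.v *)
From HB Require Import structures.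
From mathcomp Require Import all_boot all_order all_algebra.
From mathcomp Require Import boolp classical_sets functions cardinality fsbigop.
From mathcomp Require Import zify.

Set Implicit Arguments.
Unset Strict Implicit.
Unset Printing Implicit Defensive.

Import Order.TTheory GRing.Theory Num.Theory.

Local Open Scope ring_scope.

Section FirstOrder.
Variable R : unitRingType.
Implicit Types (t : GRing.term R) (f : GRing.formula R).

(* [GRing.Const] injects arbitrary elements of the structure into terms: these
   are the parameters.  [GRing.NatConst n] is the closed term 1 + ... + 1. *)
Fixpoint param_free_term t : bool :=
  match t with
  | GRing.Var _ | GRing.NatConst _ => true
  | GRing.Const _ => false
  | GRing.Add t1 t2 | GRing.Mul t1 t2 => param_free_term t1 && param_free_term t2
  | GRing.Opp t1 | GRing.NatMul t1 _ | GRing.Inv t1 | GRing.Exp t1 _ =>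
      param_free_term t1
  end.

Fixpoint param_free f : bool :=
  match f with
  | GRing.Bool _ => true
  | GRing.Equal t1 t2 => param_free_term t1 && param_free_term t2
  | GRing.Unit t1 => param_free_term t1
  | GRing.And f1 f2 | GRing.Or f1 f2 | GRing.Implies f1 f2 =>
      param_free f1 && param_free f2
  | GRing.Not f1 | GRing.Exists _ f1 | GRing.Forall _ f1 => param_free f1
  end.

Fixpoint term_vars t : seq nat :=
  match t with
  | GRing.Var i => [:: i]
  | GRing.Const _ | GRing.NatConst _ => [::]
  | GRing.Add t1 t2 | GRing.Mul t1 t2 => term_vars t1 ++ term_vars t2
  | GRing.Opp t1 | GRing.NatMul t1 _ | GRing.Inv t1 | GRing.Exp t1 _ =>
      term_vars t1
  end.

Fixpoint free_vars f : seq nat :=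
  match f with
  | GRing.Bool _ => [::]
  | GRing.Equal t1 t2 => term_vars t1 ++ term_vars t2
  | GRing.Unit t1 => term_vars t1
  | GRing.And f1 f2 | GRing.Or f1 f2 | GRing.Implies f1 f2 =>
      free_vars f1 ++ free_vars f2
  | GRing.Not f1 => free_vars f1
  | GRing.Exists i f1 | GRing.Forall i f1 => [seq j <- free_vars f1 | j != i]
  end.

Fixpoint existential f : bool :=
  match f with
  | GRing.Exists _ f1 => existential f1
  | _ => GRing.qf_form f
  end.

End FirstOrder.

(* A series [\sum_n a_n t^n] is encoded by its coefficient function
   [n |-> a_n] on the integers. *)
Definition laurent_pred (F : fieldType) : {pred int -> F} :=
  fun a => `[< exists d : int, forall n, n < d -> a n = 0 >].

Record laurent (F : fieldType) := Laurent {
  laurent_coef :> int -> F;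
  laurent_coefP : laurent_coef \in @laurent_pred F
}.

HB.instance Definition _ (F : fieldType) := [isSub for @laurent_coef F].
HB.instance Definition _ (F : fieldType) := [Choice of laurent F by <:].

Section Laurent.
Variable F : fieldType.
Implicit Types (a b c : laurent F) (d e n : int) (f g h : int -> F).

Lemma laurent_predP f :
  reflect (exists d : int, forall n, n < d -> f n = 0) (f \in @laurent_pred F).
Proof. exact: asboolP. Qed.

Lemma laurent_zmod_closed : zmod_closed (@laurent_pred F).
Proof.
split; first by apply/laurent_predP; exists 0.
move=> f g /laurent_predP[d fd] /laurent_predP[e ge].
apply/laurent_predP; exists (Num.min d e) => n.
by rewrite lt_min !fctE => /andP[/fd -> /ge ->]; rewrite subr0.
Qed.

HB.instance Definition _ :=
  GRing.isZmodClosed.Build (int -> F) (@laurent_pred F) laurent_zmod_closed.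
HB.instance Definition _ := [SubChoice_isSubZmodule of laurent F by <:].

Lemma laurentP a b : (forall n, a n = b n) -> a = b.
Proof. by move=> ab; apply/val_inj/funext. Qed.

Lemma laurent_bound a m : exists2 d : int, d <= m & forall n, n < d -> a n = 0.
Proof.
have /laurent_predP[d ad] := laurent_coefP a.
exists (Num.min d m); first by rewrite ge_min lexx orbT.
by move=> n; rewrite lt_min => /andP[/ad].
Qed.

(* Only finitely many terms are nonzero when [f] and [g] are Laurent series. *)
Definition convolution f g : int -> F :=
  fun n => \sum_(i \in [set: int]) f i * g (n - i).

Lemma convolution_sum f g d e (m : nat) :
    (forall n, n < d -> f n = 0) -> (forall n, n < e -> g n = 0) ->
  convolution f g (m%:Z + (d + e)) =
    \sum_(j < m.+1) f (j%:Z + d) * g ((m - j)%N%:Z + e).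
Proof.
move=> fd ge; rewrite /convolution.
pose r := [seq j%:Z + d | j <- iota 0 m.+1].
rewrite (fsbigE r) //; last 2 first.
- by rewrite map_inj_uniq ?iota_uniq// => i j /addIr[].
- move=> i _; case: (ltP i d) => [/fd ->|di]; first by rewrite mul0r.
  case: (ltP (m%:Z + (d + e) - i) e) => [/ge ->|ei]; first by rewrite mulr0.
  move=> /negP[]; apply/mapP; exists `|i - d|%N; last by lia.
  by rewrite mem_iota; lia.
rewrite (eq_bigl xpredT); last by move=> i; rewrite in_setT.
rewrite big_map -{1}[m.+1]subn0 -/(index_iota 0 m.+1) big_mkord.
apply: eq_bigr => j _; congr (_ * g _); have := ltn_ord j; lia.
Qed.

Lemma convolution_lt f g d e n :
    (forall n, n < d -> f n = 0) -> (forall n, n < e -> g n = 0) ->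
  n < d + e -> convolution f g n = 0.
Proof.
move=> fd ge nde; apply: fsbig1 => i _.
case: (ltP i d) => [/fd ->|di]; first by rewrite mul0r.
by rewrite ge ?mulr0//; lia.
Qed.

Lemma convolution_poly f g d e (p q : {poly F}) (m : nat) :
    (forall n, n < d -> f n = 0) -> (forall n, n < e -> g n = 0) ->
    (forall j, (j <= m)%N -> p`_j = f (j%:Z + d)) ->
    (forall j, (j <= m)%N -> q`_j = g (j%:Z + e)) ->
  convolution f g (m%:Z + (d + e)) = (p * q)`_m.
Proof.
move=> fd ge pf qg; rewrite convolution_sum// coefM.
by apply: eq_bigr => j _; rewrite pf ?qg ?leq_subr// -ltnS.
Qed.

Lemma convolution_closed a b : convolution a b \in @laurent_pred F.
Proof.
have [d _ ad] := laurent_bound a 0; have [e _ be] := laurent_bound b 0.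
by apply/laurent_predP; exists (d + e) => n; apply: convolution_lt.
Qed.

Lemma laurent_one_closed : (fun n : int => (n == 0)%:R) \in @laurent_pred F.
Proof. by apply/laurent_predP; exists 0 => n n0; rewrite lt_eqF. Qed.

Definition laurent_one : laurent F := Laurent laurent_one_closed.
Definition laurent_mul a b : laurent F := Laurent (convolution_closed a b).

Let trunc (m : nat) d f : {poly F} := \poly_(j < m.+1) f (j%:Z + d).

Let truncE m d f j : (j <= m)%N -> (trunc m d f)`_j = f (j%:Z + d).
Proof. by move=> jm; rewrite coef_poly ltnS jm. Qed.

Lemma laurent_mulC : commutative laurent_mul.
Proof.
move=> a b; apply: laurentP => n /=.
have [d dn ad] := laurent_bound a (- `|n|).
have [e en be] := laurent_bound b (- `|n|).
have -> : n = (absz (n - (d + e))%R)%:Z + (d + e) by lia.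
set m := absz _.
rewrite (convolution_poly ad be (@truncE m d a) (@truncE m e b)).
by rewrite [d + e]addrC (convolution_poly be ad (@truncE m e b) (@truncE m d a))
  mulrC.
Qed.

Lemma laurent_mulA : associative laurent_mul.
Proof.
move=> a b c; apply: laurentP => n /=.
have [d dn ad] := laurent_bound a (- `|n|).
have [e en be] := laurent_bound b (- `|n|).
have [l ln cl] := laurent_bound c (- `|n|).
have -> : n = (absz (n - (d + e + l))%R)%:Z + (d + e + l) by lia.
set m := absz _.
have P1 j : (j <= m)%N ->
    (trunc m d a * trunc m e b)`_j = convolution a b (j%:Z + (d + e)).
  move=> jm; apply/esym/(convolution_poly ad be) => i ij;
    exact/truncE/(leq_trans ij jm).
have P2 j : (j <= m)%N ->
    (trunc m e b * trunc m l c)`_j = convolution b c (j%:Z + (e + l)).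
  move=> jm; apply/esym/(convolution_poly be cl) => i ij;
    exact/truncE/(leq_trans ij jm).
rewrite (convolution_poly (fun k => @convolution_lt _ _ _ _ k ad be) cl P1
  (@truncE m l c)).
rewrite -addrA (convolution_poly ad (fun k => @convolution_lt _ _ _ _ k be cl)
  (@truncE m d a) P2).
by rewrite mulrA.
Qed.

Lemma laurent_mul1 : left_id laurent_one laurent_mul.
Proof.
move=> a; apply: laurentP => n /=.
have [d dn ad] := laurent_bound a (- `|n|).
have -> : n = (absz (n - d)%R)%:Z + (0 + d) by lia.
set m := absz _.
rewrite (@convolution_poly _ _ _ _ 1 (trunc m d a))//.
- by rewrite mul1r truncE// add0r.
- by move=> k k0; rewrite lt_eqF.
- by move=> j _; rewrite coef1 addr0.
- exact: truncE.
Qed.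

Lemma laurent_mulDl : left_distributive laurent_mul +%R.
Proof.
move=> a b c; apply: laurentP => n /=.
have [d dn ad] := laurent_bound a (- `|n|).
have [e en be] := laurent_bound b (- `|n|).
have [l ln cl] := laurent_bound c (- `|n|).
pose k := Num.min d e.
have ak i : i < k -> a i = 0 by rewrite lt_min => /andP[/ad].
have bk i : i < k -> b i = 0 by rewrite lt_min => /andP[_ /be].
have abk i : i < k -> (a + b) i = 0.
  by move=> ik; rewrite -[LHS]/(a i + b i) ak ?bk ?addr0.
have kd : k <= d by rewrite ge_min lexx.
have -> : n = (absz (n - (k + l))%R)%:Z + (k + l) by lia.
rewrite -[RHS]/(convolution a c _ + convolution b c _) !convolution_sum//.
by rewrite -big_split /=; apply: eq_bigr => j _; rewrite -mulrDl.
Qed.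

Lemma laurent_one_neq0 : laurent_one != 0.
Proof.
apply/eqP => /(congr1 (fun a : laurent F => a 0)) /= /eqP.
by rewrite -[X in _ == X]/(0 : F) oner_eq0.
Qed.

HB.instance Definition _ := GRing.Zmodule_isComNzRing.Build (laurent F)
  laurent_mulA laurent_mulC laurent_mul1 laurent_mulDl laurent_one_neq0.

Lemma laurent_coefD a b n : (a + b) n = a n + b n.
Proof. by []. Qed.

Lemma laurent_coef1 n : (1 : laurent F) n = (n == 0)%:R.
Proof. by []. Qed.

Lemma laurent_coefM a b n : (a * b) n = \sum_(i \in [set: int]) a i * b (n - i).
Proof. by []. Qed.

(* The first [n] coefficients of the inverse of [\sum_j u_j t^j]. *)
Fixpoint inverse_coefs (u : nat -> F) (n : nat) : seq F :=
  if n is m.+1 then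
    let s := inverse_coefs u m in
    rcons s ((u 0)^-1 * ((m == 0)%:R - \sum_(i < m) u (m - i)%N * s`_i))
  else [::].

Lemma size_inverse_coefs u (n : nat) : size (inverse_coefs u n) = n.
Proof. by elim: n => //= n IH; rewrite size_rcons IH. Qed.

Lemma nth_inverse_coefs u (n j : nat) :
  (j < n)%N -> (inverse_coefs u n)`_j = (inverse_coefs u j.+1)`_j.
Proof.
elim: n => // n IH; rewrite ltnS leq_eqVlt => /predU1P[->//|jn].
by rewrite -IH//= nth_rcons size_inverse_coefs jn.
Qed.

Lemma inverse_coefsP u m : u 0 != 0 ->
  \sum_(i < m.+1) (inverse_coefs u i.+1)`_i * u (m - i)%N = (m == 0)%:R.
Proof.
move=> u0; rewrite big_ord_recr/= nth_rcons size_inverse_coefs ltnn eqxx subnn.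
rewrite [X in _ + X]mulrC mulVKf//.
rewrite (eq_bigr (fun i : 'I_m => u (m - i)%N * (inverse_coefs u m)`_i)).
  by rewrite addrC subrK.
by move=> i _; rewrite mulrC (nth_inverse_coefs u (ltn_ord i)).
Qed.

Lemma laurent_inverse a : a != 0 -> exists b, b * a = 1.
Proof.
move=> a0.
have [n an] : exists n, a n != 0.
  apply: contrapT => /forallNP an; move/eqP: a0; apply; apply: laurentP => n.
  by apply/eqP/negPn/negP/an.
have [d dn ad] := laurent_bound a n.
have exk : exists k : nat, a (k%:Z + d) != 0.
  by exists (absz (n - d)%R); rewrite (_ : _ + d = n)//; lia.
case: (ex_minnP exk) => k ak kmin.
pose u (j : nat) := a (j%:Z + (k%:Z + d)).
have u0 : u 0 != 0 by rewrite /u add0r.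
have akd i : i < k%:Z + d -> a i = 0.
  case: (ltP i d) => [/ad //|di ik]; apply/eqP/negPn/negP => ai.
  have := kmin (absz (i - d)%R); rewrite (_ : _ + d = i) => [/(_ ai)|]; lia.
pose v (i : int) : F :=
  if i + (k%:Z + d) is Posz j then (inverse_coefs u j.+1)`_j else 0.
have vlt i : i < - (k%:Z + d) -> v i = 0.
  by rewrite /v; case E : (i + _) => [j|j] //; lia.
have vP : v \in @laurent_pred F by apply/laurent_predP; exists (- (k%:Z + d)).
exists (Laurent vP); apply: laurentP => i.
rewrite -[LHS]/(convolution v a i) -[RHS]/((i == 0)%:R : F).
case: (ltP i 0) => [i0|].
  by rewrite (convolution_lt vlt akd) ?addNr// lt_eqF.
case: i => // m _.
have -> : (m%:Z == 0) = (m == 0) by [].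
rewrite -(inverse_coefsP m u0) -[in LHS](addr0 m%:Z) -(addNr (k%:Z + d)).
rewrite convolution_sum//; apply: eq_bigr => j _; congr (_ * _).
by rewrite /v subrK.
Qed.

Definition laurent_inv a : laurent F := xget 0 [set b | b * a = 1]%classic.

Lemma laurent_mulVf a : a != 0 -> laurent_inv a * a = 1.
Proof. by move=> /laurent_inverse; exact: xgetPex. Qed.

Lemma laurent_inv0 : laurent_inv 0 = 0.
Proof.
apply: xgetPN => b /=; rewrite mulr0 => /esym/eqP.
by rewrite oner_eq0.
Qed.

HB.instance Definition _ :=
  GRing.ComNzRing_isField.Build (laurent F) laurent_mulVf laurent_inv0.

Definition power_series : {pred laurent F} :=
  fun a => `[< forall n : int, n < 0 -> a n = 0 >].

Lemma power_seriesP a :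
  reflect (forall n : int, n < 0 -> a n = 0) (a \in power_series).
Proof. exact: asboolP. Qed.

Lemma power_series_subring_closed : subring_closed power_series.
Proof.
split.
- by apply/power_seriesP => n n0; rewrite -[LHS]/((n == 0)%:R : F) lt_eqF.
- move=> a b /power_seriesP a0 /power_seriesP b0; apply/power_seriesP => n n0.
  by rewrite -[LHS]/(a n - b n) a0 ?b0 ?subr0.
- move=> a b /power_seriesP a0 /power_seriesP b0; apply/power_seriesP => n n0.
  exact: (convolution_lt a0 b0).
Qed.

HB.instance Definition _ := GRing.isSubringClosed.Build (laurent F)
  power_series power_series_subring_closed.

End Laurent.

Arguments power_series {F}.

(* Main.v *)
(* With q = #|F| and f(Y) = Y^q - Y + 1, one has F[[t]] = F + {1 / f(y) : y in F((t))}.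
   For the inclusion from right to left, f(y) has a pole as soon as y has one, and otherwise
   f(y) has constant coefficient 1, since f is constantly 1 on F; in both cases 1 / f(y) is a
   power series. Conversely, if u is a power series with constant coefficient 1, then so is
   1 / u = 1 - v, and y = v + v^q + v^(q^2) + ... converges and satisfies f(y) = 1 - v because
   raising to the power q is additive. Finally F is the set of solutions of c^q = c. *)
Require Import Defs.
From mathcomp Require Import all_boot all_order all_algebra.
From mathcomp Require Import finfield ring zify.

Set Implicit Arguments.
Unset Strict Implicit.
Unset Printing Implicit Defensive.

Import Order.TTheory GRing.Theory Num.Theory.

(** * Orders, leading coefficients and constants in the field of Laurent series *)

Section LaurentOrder.
Variable F : fieldType.
Implicit Types (a b : laurent F) (d e : int) (c : F).
Local Open Scope ring_scope.

(** A lower bound on the t-adic valuation; 0 satisfies it for every [d], so no value has to be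
    assigned to 0. *)
Definition vanishes_below d a := forall n : int, n < d -> a n = 0.

Lemma vanishes_belowW d e a : e <= d -> vanishes_below d a -> vanishes_below e a.
Proof. by move=> ed ad n ne; apply/ad/(lt_le_trans ne). Qed.

Lemma vanishes_belowD d a b :
  vanishes_below d a -> vanishes_below d b -> vanishes_below d (a + b).
Proof. by move=> ad bd n nd; rewrite laurent_coefD ad ?bd ?addr0. Qed.

Lemma laurent_coefN a n : (- a) n = - a n.
Proof. by []. Qed.

Lemma laurent_coef0 n : (0 : laurent F) n = 0.
Proof. by []. Qed.

Lemma vanishes_belowN d a : vanishes_below d a -> vanishes_below d (- a).
Proof. by move=> ad n nd; rewrite laurent_coefN ad ?oppr0. Qed.

Lemma vanishes_below1 : vanishes_below 0 (1 : laurent F).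
Proof. by move=> n n0; rewrite laurent_coef1 lt_eqF. Qed.

Lemma vanishes_belowM d e a b :
  vanishes_below d a -> vanishes_below e b -> vanishes_below (d + e) (a * b).
Proof. by move=> ad be n; apply: (convolution_lt ad be). Qed.

Lemma vanishes_belowX d a n : vanishes_below d a -> vanishes_below (d * n%:Z) (a ^+ n).
Proof.
move=> ad; elim: n => [|n IHn]; first by rewrite mulr0; exact: vanishes_below1.
rewrite exprS (_ : d * n.+1%:Z = d + d * n%:Z); last by lia.
exact: vanishes_belowM.
Qed.

(** In the lowest possible degree the convolution has a single term. *)
Lemma lead_coefM d e a b : vanishes_below d a -> vanishes_below e b ->
  (a * b) (d + e) = a d * b e.
Proof.
move=> ad be; rewrite -[X in (a * b) X]add0r -[LHS]/(convolution a b (0%:Z + (d + e))).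
by rewrite (convolution_sum 0 ad be) big_ord1 !add0r.
Qed.

Lemma lead_coefX d a n : vanishes_below d a -> (a ^+ n) (d * n%:Z) = a d ^+ n.
Proof.
move=> ad; elim: n => [|n IHn]; first by rewrite mulr0 laurent_coef1.
rewrite !exprS (_ : d * n.+1%:Z = d + d * n%:Z); last by lia.
by rewrite lead_coefM ?IHn//; exact: vanishes_belowX.
Qed.

Lemma laurent_order a : a != 0 -> exists2 d, vanishes_below d a & a d != 0.
Proof.
move=> a0.
have [n an] : exists n, a n != 0.
  apply: boolp.contrapT => /boolp.forallNP an; move/eqP: a0; apply.
  by apply: laurentP => n; apply/eqP/negPn/negP/an.
have [d dn ad] := laurent_bound a n.
have exk : exists k : nat, a (k%:Z + d) != 0.
  by exists `|n - d|%N; rewrite (_ : _ + d = n)//; lia.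
case: (ex_minnP exk) => k ak kmin; exists (k%:Z + d) => // i ik.
case: (ltP i d) => [/ad //|di]; apply/eqP/negPn/negP => ai.
have := kmin `|i - d|%N; rewrite (_ : _ + d = i) => [/(_ ai)|]; lia.
Qed.

(** Leading coefficients multiply to a nonzero element of [F], so the orders of [a] and [b] add up
    to that of 1, which is 0. *)
Lemma vanishes_below_mul_eq1 d a b : vanishes_below d a -> a d != 0 -> a * b = 1 ->
  vanishes_below (- d) b.
Proof.
move=> ad ad0 ab1.
have b0 : b != 0 by apply/eqP => b0; move: (oner_neq0 (laurent F)); rewrite -ab1 b0 mulr0 eqxx.
have [e be be0] := laurent_order b0.
have := lead_coefM ad be; rewrite ab1 laurent_coef1 => /esym/eqP.
case: (eqVneq (d + e) 0) => [de _|_]; last by rewrite mulf_eq0 (negPf ad0) (negPf be0).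
by rewrite (_ : - d = e)//; lia.
Qed.

Lemma laurent_const_subproof c :
  (fun n : int => if n == 0 then c else 0) \in @laurent_pred F.
Proof. by apply/laurent_predP; exists 0 => n n0; rewrite lt_eqF. Qed.

Definition laurent_const c : laurent F := Laurent (laurent_const_subproof c).

Lemma laurent_constM c c' : laurent_const (c * c') = laurent_const c * laurent_const c'.
Proof.
apply: laurentP => n.
have below0 x : vanishes_below 0 (laurent_const x) by move=> i i0 /=; rewrite lt_eqF.
case: n => [m|m]; last first.
  by rewrite below0// (vanishes_belowM (below0 c) (below0 c')).
have coefP x j : (j <= m)%N -> x%:P`_j = laurent_const x (j%:Z + 0).
  by move=> _; rewrite coefC addr0.
have := convolution_poly (below0 c) (below0 c') (coefP c) (coefP c').
by rewrite !addr0 -polyCM coefC => /esym.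
Qed.

Lemma laurent_constX c n : laurent_const (c ^+ n) = laurent_const c ^+ n.
Proof.
elim: n => [|n IHn]; last by rewrite !exprS laurent_constM IHn.
by apply: laurentP => n; rewrite /= /laurent_one /=; case: (n == 0).
Qed.

Lemma pchar_laurent p : p \in [pchar F] -> p \in [pchar (laurent F)].
Proof.
move=> /andP[p_prime /eqP p0]; apply/andP; split=> //; apply/eqP/laurentP => n.
have coefMn m : (m%:R : laurent F) n = (n == 0)%:R *+ m.
  by elim: m => [|m IHm]; rewrite ?mulr0n// !mulrS laurent_coefD IHm laurent_coef1.
by rewrite coefMn laurent_coef0 -mulr_natr p0 mulr0.
Qed.

End LaurentOrder.

(** * Integrality of solutions, by comparing orders *)

Section FiniteResidueField.
Variable F : finFieldType.
Local Open Scope ring_scope.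
Local Notation q := #|F|.
Implicit Types (c u y : laurent F).

(** A pole of order r in [c] would give a pole of order qr > r in [c ^+ q]. *)
Lemma frobenius_fixed_power_series c : c ^+ q = c -> c \in power_series.
Proof.
move=> cq; have q_gt1 : (1 < q)%N by exact: finRing_gt1.
have [->|/laurent_order[d cd cd0]] := eqVneq c 0; first exact: rpred0.
apply/power_seriesP => n n0; apply: (cd); apply: lt_le_trans n0 _.
rewrite leNgt; apply/negP => d0.
have := lead_coefX q cd; rewrite cq cd; last by nia.
by move/esym/eqP; rewrite expf_eq0 (negPf cd0) andbF.
Qed.

Lemma inverse_artin_schreier_power_series u y :
  u * (y ^+ q - y + 1) = 1 -> u \in power_series.
Proof.
move=> uy1; have q_gt1 : (1 < q)%N by exact: finRing_gt1.
(* Here [e] is the order of f(y): 0 if [y] is a power series, q times the order of [y] otherwise.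
   Then [u] has order - e >= 0. *)
suff [e e0 [fe fe0]] : exists2 e, e <= 0 &
    vanishes_below e (y ^+ q - y + 1) /\ (y ^+ q - y + 1) e != 0.
  apply/power_seriesP => n n0; apply: (vanishes_below_mul_eq1 fe fe0); last by lia.
  by rewrite mulrC.
have [y0|y0] := boolP (y \in power_series).
  have yb : vanishes_below 0 y by exact/power_seriesP.
  exists 0 => //; split.
    apply: vanishes_belowD; last exact: vanishes_below1.
    apply: vanishes_belowD; last exact: vanishes_belowN.
    by rewrite -(mul0r q%:Z); exact: vanishes_belowX.
  rewrite !laurent_coefD laurent_coefN laurent_coef1.
  have := lead_coefX q yb; rewrite mul0r => ->.
  by rewrite expf_card subrr add0r oner_neq0.
have [|d yd yd0] := @laurent_order _ y.
  by apply: contraNneq y0 => ->; exact: rpred0.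
have d0 : d < 0.
  rewrite ltNge; apply: contra y0 => d0; apply/power_seriesP => n n0.
  by apply: yd; exact: lt_le_trans d0.
exists (d * q%:Z); first by nia.
have dq : d * q%:Z < d by nia.
split.
  apply: vanishes_belowD; last by refine (vanishes_belowW _ (@vanishes_below1 _)); nia.
  apply: vanishes_belowD; first exact: vanishes_belowX.
  by apply: vanishes_belowN; refine (vanishes_belowW _ yd); exact: ltW.
(* In degree dq < d < 0 only [y ^+ q] contributes. *)
rewrite !laurent_coefD laurent_coefN laurent_coef1 lead_coefX//.
rewrite (yd _ dq) subr0 lt_eqF ?addr0 ?expf_neq0//; lia.
Qed.

End FiniteResidueField.

(** * Solving the Artin-Schreier equation *)

Section ArtinSchreier.
Variables (p k : nat) (F : finFieldType).
Hypotheses (p_prime : prime p) (cardF : #|F| = (p ^ k)%N).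
Local Open Scope ring_scope.
Local Notation q := #|F|.
Implicit Types (a b v : laurent F).

(** q is a power of the characteristic [p]. *)
Lemma laurent_exprD_card a b : (a + b) ^+ q = a ^+ q + b ^+ q.
Proof.
apply: GRing.exprDn_pchar; rewrite cardF pnatX; apply/orP; left.
by rewrite pnatE//; exact: pchar_laurent (card_finPcharP cardF p_prime).
Qed.

(* The n-th coefficient of the sum of all [v ^+ (q ^ i)] is that of a partial sum, since
   [v ^+ (q ^ i)] vanishes below [q ^ i > i]. *)
Lemma artin_schreier_solution v : vanishes_below 1 v -> exists y, y - y ^+ q = v.
Proof.
move=> v1; have q_gt1 : (1 < q)%N by exact: finRing_gt1.
pose s (m : nat) : laurent F := \sum_(i < m) v ^+ (q ^ i).
have s_recr m : s m.+1 = s m + v ^+ (q ^ m) by exact: big_ord_recr.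
(* By additivity, raising to the power q shifts each term of the sum to the next one; only the first
   term [v] has to be added back. *)
have s_frob m : s m.+1 = s m ^+ q + v.
  elim: m => [|m IHm].
    by rewrite s_recr /s big_ord0 expn0 expr1 expr0n gtn_eqF ?(ltnW q_gt1).
  by rewrite s_recr {1}IHm s_recr laurent_exprD_card -exprM -expnSr addrAC.
have term_below i : vanishes_below i.+1 (v ^+ (q ^ i)).
  refine (vanishes_belowW _ (vanishes_belowX (n := (q ^ i)%N) v1)).
  by rewrite mul1r lez_nat; exact: ltn_expl.
have s_stable m n j : (m <= n)%N -> j < m%:Z + 1 -> s n j = s m j.
  elim: n => [|n IHn]; first by rewrite leqn0 => /eqP->.
  rewrite leq_eqVlt => /predU1P[->//|]; rewrite ltnS => mn jm.
  rewrite s_recr laurent_coefD IHn// term_below ?addr0//; lia.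
(* By [s_stable], degree n no longer changes after [s n]. For n < 0 the absolute value is a harmless
   default, since every [s m] vanishes below 1. *)
pose yf (n : int) : F := s `|n|%N n.
have s_below m : vanishes_below 1 (s m).
  elim: m => [|m IHm]; first by rewrite /s big_ord0.
  rewrite s_recr; apply: vanishes_belowD => //.
  by refine (vanishes_belowW _ (term_below m)).
have yP : yf \in @laurent_pred F.
  by apply/laurent_predP; exists 1 => n n1; exact: s_below.
pose y := Laurent yP.
have y_approx m : vanishes_below (m%:Z + 1) (y - s m).
  move=> n nm; rewrite laurent_coefD laurent_coefN /= /yf.
  case: (ltP n 1) => n1; first by rewrite !s_below// subrr.
  by rewrite (@s_stable `|n|%N m)// ?subrr//; lia.
exists y; apply: laurentP => n.
(* Both error terms vanish in degree n: the first vanishes below |n| + 2, the second below (|n| +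
   1)q. *)
have -> : y - y ^+ q = v + (y - s `|n|%N.+1) - (y - s `|n|%N) ^+ q.
  have -> : y ^+ q = (y - s `|n|%N) ^+ q + s `|n|%N ^+ q by rewrite -laurent_exprD_card subrK.
  by rewrite s_frob; ring.
rewrite laurent_coefD laurent_coefN laurent_coefD y_approx ?addr0; last by lia.
rewrite (vanishes_belowX (n := q) (y_approx `|n|%N)) ?subr0//.
by apply: (@lt_le_trans _ _ (`|n|%N%:Z + 1)); [lia|nia].
Qed.

Lemma power_series_artin_schreier a : a \in power_series ->
  exists c y, c ^+ q = c /\ (a - c) * (y ^+ q - y + 1) = 1.
Proof.
(* This constant gives [a - c], and hence its inverse, constant coefficient 1. *)
move=> /power_seriesP a0; pose c := laurent_const (a 0 - 1).
have ac0 : (a - c) 0 = 1 by rewrite laurent_coefD laurent_coefN /= opprB addrC subrK.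
have acb : vanishes_below 0 (a - c).
  by move=> n n0; rewrite laurent_coefD laurent_coefN a0//= lt_eqF ?subr0.
have ac_neq0 : a - c != 0.
  by apply/eqP => ac; move/eqP: ac0; rewrite ac laurent_coef0 eq_sym oner_eq0.
have acV : (a - c) * (a - c)^-1 = 1 by exact: mulfV.
have wb : vanishes_below 0 (a - c)^-1.
  by rewrite -oppr0; apply: vanishes_below_mul_eq1 acV; rewrite // ac0 oner_neq0.
have w0 : (a - c)^-1 0 = 1.
  by have := lead_coefM acb wb; rewrite acV ac0 mul1r addr0 laurent_coef1 => <-.
(* With w the inverse of [a - c], the equation f(y) = w reads y - y^q = 1 - w, whose right-hand side
   has no constant term. *)
have [|y yv] := @artin_schreier_solution (1 - (a - c)^-1).
  move=> n n1; rewrite laurent_coefD laurent_coefN laurent_coef1.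
  case: (ltP n 0) => n0; first by rewrite wb// lt_eqF// subr0.
  by rewrite (_ : n = 0) ?w0 ?subrr//; lia.
exists c, y; split; first by rewrite -laurent_constX expf_card.
by rewrite -[y ^+ q - y]opprB yv opprB subrK.
Qed.

End ArtinSchreier.

Theorem theorem1p1 (p k : nat) (F : finFieldType)
    (p_prime : prime p) (k_gt0 : 1 <= k) (cardF : #|F| = p ^ k) :
  exists chi : GRing.formula (laurent F),
    [/\ existential chi,
        GRing.rformula chi,
        param_free chi,
        {subset free_vars chi <= [:: 0]} &
        forall a : laurent F, GRing.holds [:: a] chi <-> a \in power_series].
Proof.
(* Variables 0, 1, 2 stand for a, c, y. The equation (a - c) f(y) = 1 expresses a - c = 1 / f(y)
   without division and forces f(y) to be nonzero. *)
pose X i := GRing.Var (laurent F) i.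
pose f := GRing.Add (GRing.Add (GRing.Exp (X 2) #|F|) (GRing.Opp (X 2))) (GRing.NatConst _ 1).
exists (GRing.Exists 1 (GRing.Exists 2 (GRing.And
  (GRing.Equal (GRing.Exp (X 1) #|F|) (X 1))
  (GRing.Equal (GRing.Mul (GRing.Add (X 0) (GRing.Opp (X 1))) f) (GRing.NatConst _ 1))))).
split=> // a; split=> [[c [y /= [cq acy]]]|/(power_series_artin_schreier p_prime cardF)].
  rewrite -(GRing.subrK c a); apply: GRing.rpredD.
    exact: inverse_artin_schreier_power_series acy.
  exact: frobenius_fixed_power_series cq.
by move=> [c [y cy]]; exists c, y.
Qed.
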